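(* Let $m\ge 3$ be an integer and let $\Gamma_{D_{2m}}$ be the non-commuting graph of the dihedral group $D_{2m}=\langle a,b : a^m=b^2=1,\ bab^{-1}=a^{-1}\rangle$. Then: (a) $E(\Gamma_{D_{2m}})\le LE^+(\Gamma_{D_{2m}})\le LE(\Gamma_{D_{2m}})$, and equality holds (in either inequality) if and only if $m=4$, i.e. the group is $D_8$. (b) $\Gamma_{D_{2m}}$ is neither hypoenergetic nor hyperenergetic. (c) $\Gamma_{D_6}$ is L-hyperenergetic but not Q-hyperenergetic; $\Gamma_{D_8}$ is neither L-hyperenergetic nor Q-hyperenergetic; and if $m\ne 3,4$ then $\Gamma_{D_{2m}}$ is both Q-hyperenergetic and L-hyperenergetic.
   Context: For a finite non-abelian group $G$ with center $Z(G)$, the non-commuting graph $\Gamma_G$ is the simple undirected graph with vertex set $G\setminus Z(G)$ in which $x,y$ are adjacent iff $xy\ne yx$. For a finite simple graph $\mathcal G$ with vertex set $v(\mathcal G)$, edge set $e(\mathcal G)$, adjacency matrix $A(\mathcal G)$ and diagonal degree matrix $D(\mathcal G)$, put $L(\mathcal G)=D(\mathcal G)-A(\mathcal G)$ (Laplacian) and $Q(\mathcal G)=D(\mathcal G)+A(\mathcal G)$ (signless Laplacian). With sums over eigenvalues counted with multiplicity, define $E(\mathcal G)=\sum_{\lambda}|\lambda|$ ($\lambda$ eigenvalues of $A(\mathcal G)$), $LE(\mathcal G)=\sum_{\beta}\left|\beta-\frac{2|e(\mathcal G)|}{|v(\mathcal G)|}\right|$ ($\beta$ eigenvalues of $L(\mathcal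 G)$), $LE^+(\mathcal G)=\sum_{\gamma}\left|\gamma-\frac{2|e(\mathcal G)|}{|v(\mathcal G)|}\right|$ ($\gamma$ eigenvalues of $Q(\mathcal G)$). With $K_n$ the complete graph on $n$ vertices, $\mathcal G$ is called hyperenergetic if $E(\mathcal G)>E(K_{|v(\mathcal G)|})$, hypoenergetic if $E(\mathcal G)<|v(\mathcal G)|$, L-hyperenergetic if $LE(\mathcal G)>LE(K_{|v(\mathcal G)|})$, and Q-hyperenergetic if $LE^+(\mathcal G)>LE^+(K_{|v(\mathcal G)|})$. *)

(* Defs.v *)
From HB Require Import structures.
From mathcomp Require Import all_boot all_order all_algebra.
From mathcomp Require Import all_fingroup all_solvable all_field.

Set Implicit Arguments.
Unset Strict Implicit.
Unset Printing Implicit Defensive.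

Import Order.TTheory GRing.Theory Num.Theory.
Local Open Scope ring_scope.

Record sgraph := SGraph {
  vertex : finType;
  adj : rel vertex;
  adj_sym : symmetric adj;
  adj_irrefl : irreflexive adj
}.

Section Spectrum.

Variable n : nat.
Implicit Type A : 'M[algC]_n.

(* Algebraic multiplicities are used; on the symmetric matrices below they
   coincide with the geometric ones. *)
Definition eigenvalues A : seq algC :=
  sval (closed_field_poly_normal (char_poly A)).

Lemma eigenvaluesE A :
  char_poly A = \prod_(z <- eigenvalues A) ('X - z%:P).
Proof.
rewrite /eigenvalues; case: closed_field_poly_normal => r /= {1}->.
by rewrite (monicP (char_poly_monic A)) scale1r.
Qed.

End Spectrum.

Section GraphEnergies.

Variable X : sgraph.

Definition order_of : nat := #|vertex X|.

Definition edges : {set {set vertex X}} :=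
  [set [set p.1; p.2] | p : vertex X * vertex X & adj p.1 p.2].

Definition degree (x : vertex X) : nat := #|[set y | adj x y]|.

Definition adjmx : 'M[algC]_order_of :=
  \matrix_(i, j) (adj (enum_val i) (enum_val j))%:R.

Definition degmx : 'M[algC]_order_of :=
  diag_mx (\row_i (degree (enum_val i))%:R).

Definition laplacian : 'M[algC]_order_of := degmx - adjmx.

Definition signless_laplacian : 'M[algC]_order_of := degmx + adjmx.

Definition average_degree : algC := (2 * #|edges|)%:R / order_of%:R.

(* The three energies are sums of norms, hence real, so that the partial order
   of algC compares them as real numbers. *)
Definition energy : algC := \sum_(z <- eigenvalues adjmx) `|z|.

Definition L_energy : algC :=
  \sum_(z <- eigenvalues laplacian) `|z - average_degree|.

Definition Q_energy : algC :=
  \sum_(z <- eigenvalues signless_laplacian) `|z - average_degree|.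

End GraphEnergies.

Section CompleteGraph.

Variable n : nat.

Definition complete_adj : rel 'I_n := fun i j => i != j.

Lemma complete_adj_sym : symmetric complete_adj.
Proof. by move=> i j; rewrite /complete_adj eq_sym. Qed.

Lemma complete_adj_irrefl : irreflexive complete_adj.
Proof. by move=> i; rewrite /complete_adj eqxx. Qed.

Definition complete_graph : sgraph :=
  SGraph complete_adj_sym complete_adj_irrefl.

End CompleteGraph.

Definition hyperenergetic (X : sgraph) : Prop :=
  energy X > energy (complete_graph (order_of X)).

Definition hypoenergetic (X : sgraph) : Prop :=
  energy X < (order_of X)%:R.

Definition L_hyperenergetic (X : sgraph) : Prop :=
  L_energy X > L_energy (complete_graph (order_of X)).

Definition Q_hyperenergetic (X : sgraph) : Prop :=
  Q_energy X > Q_energy (complete_graph (order_of X)).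

Section NonCommutingGraph.

Local Open Scope group_scope.

Variables (gT : finGroupType) (G : {group gT}).

Definition noncentral := {x : gT | x \in G :\: 'Z(G)}.

Definition nc_adj : rel noncentral :=
  fun x y => val x * val y != val y * val x.

Lemma nc_adj_sym : symmetric nc_adj.
Proof. by move=> x y; rewrite /nc_adj eq_sym. Qed.

Lemma nc_adj_irrefl : irreflexive nc_adj.
Proof. by move=> x; rewrite /nc_adj eqxx. Qed.

Definition noncommuting_graph : sgraph := SGraph nc_adj_sym nc_adj_irrefl.

End NonCommutingGraph.

(* Main.v *)
(** Let [s = |Z(G)|], which is 1 or 2, and write [m = s (t + 1)].  Two noncentral
elements commute iff both are rotations or they lie in the same coset of the
center, so the graph is complete multipartite, with one part of size [s t] and
[t + 1] parts of size [s].  On such a graph [x - A], [x - L] and [x - Q] are a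
diagonal matrix constant on parts plus a matrix factoring through the parts;
two applications of Sylvester's determinant identity give the characteristic
polynomials, whose only irrational roots are those of one quadratic factor.
Hence [E = s (t + sqrt (5t^2 + 4t))], [LE] is rational, and [LE^+] is rational
plus [s sqrt (8t^2 + 1)].  Complete graphs, of energies [2 (n - 1)], are covered
by the same formula, and linear bounds on the two square roots decide all the
comparisons, the equality case being [s = 2], [t = 1]. *)

Require Import Defs.
From mathcomp Require Import all_boot all_order all_algebra.
From mathcomp Require Import all_fingroup all_solvable all_field.
From mathcomp Require Import ring lra zify.
Import Order.TTheory GRing.Theory Num.Theory.
Local Open Scope ring_scope.

(** * Determinants of a diagonal matrix plus a low-rank one *)

(** Sylvester's determinant identity, from the two block-triangular reductions
of [block_mx 1 U (- V) 1]. *)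
Lemma det_add1_mulmxC (R : comNzRingType) n r (U : 'M[R]_(n, r)) (V : 'M[R]_(r, n)) :
  \det (1%:M + U *m V) = \det (1%:M + V *m U).
Proof.
pose B := block_mx 1%:M U (- V) 1%:M.
have detB1 : \det B = \det (1%:M + U *m V).
  have : block_mx 1%:M (- U) 0 1%:M *m B = block_mx (1%:M + U *m V) 0 (- V) 1%:M.
    rewrite mulmx_block !mul1mx !mulmx1 !mul0mx !add0r mulNmx mulmxN opprK.
    by rewrite subrr.
  move/(congr1 determinant).
  by rewrite det_mulmx det_ublock det_lblock !det1 !mul1r mulr1.
have : B *m block_mx 1%:M (- U) 0 1%:M = block_mx 1%:M 0 (- V) (1%:M + V *m U).
  rewrite mulmx_block !mulmx1 !mul1mx !mulmx0 !addr0 mulNmx mulmxN opprK.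
  by rewrite addNr addrC.
move/(congr1 determinant).
by rewrite det_mulmx det_ublock det_lblock !det1 !mul1r mulr1 -detB1.
Qed.

(** Pulling out the invertible diagonal leaves a matrix to which [det_add1_mulmxC] applies, so an
    [n] by [n] determinant becomes an [r] by [r] one. *)
Lemma det_diag_addmul (F : fieldType) n r (d : 'rV[F]_n)
    (U : 'M[F]_(n, r)) (V : 'M[F]_(r, n)) :
    (forall i, d 0 i != 0) ->
  \det (diag_mx d + U *m V) =
  \prod_i d 0 i * \det (1%:M + V *m diag_mx (\row_i (d 0 i)^-1) *m U).
Proof.
move=> d_neq0; set d' := \row_i _.
have dd' : diag_mx d *m diag_mx d' = 1%:M.
  apply/matrixP=> i j; rewrite mul_diag_mx !mxE.
  by case: eqP => [->|_]; rewrite ?mulr0 // mulr1n divff.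
have -> : diag_mx d + U *m V = diag_mx d *m (1%:M + (diag_mx d' *m U) *m V).
  by rewrite mulmxDr mulmx1 !mulmxA dd' mul1mx.
by rewrite det_mulmx det_diag det_add1_mulmxC mulmxA.
Qed.

(** With [C] the incidence matrix of vertices and labels, [J] the all-ones matrix and
    [W = e (1 - J)], the matrix is [diag f + C W C^T]. A first reduction passes from vertices to
    labels; there [W] is scalar plus rank one, so a second reduction ends with a 1 by 1 determinant.
    A label that no vertex uses has [N a = 0] and contributes a factor 1 and a summand 0. *)
Lemma det_multipartite (F : fieldType) n (I : finType) (c : 'I_n -> I)
    (f : I -> F) (e : F) (N := fun a => #|[pred i | c i == a]|%:R : F) :
    (forall a, f a != 0) -> (forall a, f a + e * N a != 0) ->
  \det (\matrix_(i, j) ((i == j)%:R * f (c i) + e * ((c i == c j)%:R - 1))) =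
  \prod_i f (c i) * \prod_a (1 + e * N a / f a)
    * (1 - e * \sum_a N a / (f a + e * N a)).
Proof.
move=> f_neq0 fN_neq0; set M := \matrix_(i, j) _.
pose C : 'M[F]_(n, #|I|) := \matrix_(i, a) (c i == enum_val a)%:R.
pose W : 'M[F]_#|I| := \matrix_(a, b) (e * ((a == b)%:R - 1)).
have sumC (G : I -> F) i : \sum_(a < #|I|) (c i == enum_val a)%:R * G (enum_val a) = G (c i).
  rewrite (bigD1 (enum_rank (c i))) //= enum_rankK eqxx mul1r big1 ?addr0 //.
  move=> a; rewrite -(inj_eq enum_val_inj) enum_rankK eq_sym => /negbTE->.
  by rewrite mul0r.
have -> : M = diag_mx (\row_i f (c i)) + (C *m W) *m C^T.
  apply/matrixP=> i j; rewrite !mxE mulr_natl; congr (_ + _).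
  transitivity (\sum_(a < #|I|) (c j == enum_val a)%:R * (e * ((c i == enum_val a)%:R - 1))).
    by rewrite (sumC (fun a => e * ((c i == a)%:R - 1)) j).
  apply: eq_bigr => a _; rewrite !mxE mulrC; congr (_ * _).
  rewrite -[LHS](sumC (fun b => e * ((b == enum_val a)%:R - 1)) i).
  by apply: eq_bigr => b _; rewrite !mxE (inj_eq enum_val_inj).
rewrite det_diag_addmul; last by move=> i; rewrite mxE.
rewrite -!mulrA; congr (_ * _); first by apply: eq_bigr => i _; rewrite mxE.
rewrite mulmxA.
(* The columns of [C] have disjoint supports, so this product is diagonal. *)
have -> : C^T *m diag_mx (\row_i ((\row_j f (c j)) 0 i)^-1) *m C =
          diag_mx (\row_a (N (enum_val a) / f (enum_val a))).
  apply/matrixP=> a b; rewrite !mxE.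
  rewrite (eq_bigr (fun i => ((a == b) && (c i == enum_val a))%:R / f (enum_val a))).
    rewrite -mulr_suml -natr_sum; case: eqP => [->|] /=; last first.
      by rewrite sum_nat_const muln0 mul0r.
    congr (_%:R / _); rewrite -sum1_card [RHS]big_mkcond /=.
    by apply: eq_bigr => i _; rewrite inE; case: eqP.
  move=> i _; rewrite mul_mx_diag !mxE.
  case: (eqVneq (c i) (enum_val a)) => [->|_]; last by rewrite andbF !mul0r.
  rewrite (inj_eq enum_val_inj) andbT mul1r.
  by case: eqP; rewrite ?mulr1 ?mul1r ?mulr0 ?mul0r.
pose g (a : I) := N a / f a.
have g_neq0 a : 1 + e * g a != 0.
  apply: contraNneq (fN_neq0 a) => /(congr1 ( *%R (f a))).
  rewrite mulr0 mulrDr mulr1 /g => <-; apply/eqP; congr (_ + _).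
  by rewrite mulrCA [f _ * _]mulrC divfK.
(* The scalar part of [W] joins the identity; what remains is a column times a row of ones. *)
have -> : 1%:M + diag_mx (\row_(a < #|I|) g (enum_val a)) *m W =
          diag_mx (\row_a (1 + e * g (enum_val a))) +
          (\col_a (- e * g (enum_val a))) *m (const_mx 1 : 'M_(1, #|I|)).
  apply/matrixP=> a b; rewrite mul_diag_mx !mxE big_ord1 !mxE mulr1.
  by case: eqP => _; rewrite ?mulr1n ?mulr0n; ring.
rewrite det_diag_addmul => [|a]; last by rewrite mxE.
congr (_ * _).
  rewrite (reindex (@enum_val I I)) /=; last by apply: onW_bij; exact: enum_val_bij.
  by apply: eq_bigr => a _; rewrite mxE -mulrA.
rewrite det_mx11 !mxE eqxx mulr1n; congr (1 + _).
rewrite -mulNr mulr_sumr.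
rewrite [in RHS](reindex (@enum_val I I)) /=; last by apply: onW_bij; exact: enum_val_bij.
apply: eq_bigr => a _; rewrite mul_mx_diag !mxE mul1r.
have := g_neq0 (enum_val a); rewrite /g.
move: (f_neq0 (enum_val a)) (fN_neq0 (enum_val a)) => f0 fN0 g0.
by field; rewrite f0 fN0.
Qed.

(** * Sums and products over the parts of a partition *)

Section Parts.

Variables (V I : finType) (c : V -> I) (a0 : I) (p k s : nat).

Definition part_size (a : I) : nat := #|[pred i | c i == a]|.

Definition small_parts : pred I := [pred a | (a != a0) && (part_size a == s)].

Hypothesis s_gt0 : (0 < s)%N.
Hypothesis size_a0 : part_size a0 = p.
Hypothesis size_small : forall a, a != a0 -> part_size a = 0%N \/ part_size a = s.
Hypothesis cardV : #|V| = (p + k * s)%N.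

Lemma big_parts (R : Type) (idx : R) (op : Monoid.com_law idx) (G : I -> R) :
    (forall a, a != a0 -> part_size a = 0%N -> G a = idx) ->
  \big[op/idx]_a G a = op (G a0) (\big[op/idx]_(a in small_parts) G a).
Proof.
move=> G0; rewrite (bigD1 a0) //=; congr (op _ _).
rewrite big_mkcond [RHS]big_mkcond; apply: eq_bigr => a _; rewrite inE.
case: (boolP (a != a0)) => //= a_neq; case: eqP => // nas.
by apply: G0 => //; case: (size_small _ a_neq).
Qed.

(** Counting vertices part by part gives [p + #|small_parts| * s = p + k * s], and [s] cancels. *)
Lemma card_small_parts : #|small_parts| = k.
Proof.
have : #|V| = (\sum_a part_size a)%N.
  rewrite -sum1_card (partition_big c xpredT) //=.
  by apply: eq_bigr => a _; rewrite sum1_card.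
rewrite big_parts // size_a0 (eq_bigr (fun=> s)); last first.
  by move=> a /andP[_ /eqP].
by rewrite sum_nat_const cardV => /addnI/eqP; rewrite eqn_pmul2r // => /eqP.
Qed.

Lemma prod_parts (R : comNzRingType) (f : I -> R) (f1 : R) :
  (forall a, a != a0 -> f a = f1) -> \prod_i f (c i) = f a0 ^+ p * f1 ^+ (k * s).
Proof.
move=> f_small; rewrite (bigID [pred i | c i == a0]) /=; congr (_ * _).
  rewrite (eq_bigr (fun=> f a0)) => [|i /eqP-> //].
  by rewrite prodr_const -size_a0.
rewrite (eq_bigr (fun=> f1)) => [|i /f_small //].
rewrite prodr_const; congr (_ ^+ _); apply/eqP.
by rewrite -(eqn_add2l p) -cardV -[X in (X + _)%N]size_a0 cardC.
Qed.

End Parts.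

Arguments part_size {V I} c a.

(** * Characteristic polynomials of weighted complete multipartite graphs *)

Lemma multipartite_factor (F : fieldType) (x y e : F) (p k s : nat) :
    (0 < p)%N -> (0 < k)%N -> (0 < s)%N ->
    x != 0 -> x + e * p%:R != 0 -> y != 0 -> y + e * s%:R != 0 ->
  x ^+ p * y ^+ (k * s) * ((1 + e * p%:R / x) * (1 + e * s%:R / y) ^+ k) *
    (1 - e * (p%:R / (x + e * p%:R) + s%:R / (y + e * s%:R) *+ k)) =
  x ^+ p.-1 * y ^+ (k * s - k) * (y + e *+ s) ^+ k.-1 *
  (x * y - e * x *+ (k.-1 * s) - e ^+ 2 *+ (p * (k * s))).
Proof.
move=> p_gt0 k_gt0 s_gt0 x0 xp0 y0 ys0.
(* The denominator of [1 + e * p / x] takes away one power of [x]; the numerator [x + e * p] and one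
   factor [y + e * s] clear the denominators of the last bracket, which becomes the quadratic
   factor. *)
have -> : x ^+ p = x * x ^+ p.-1 by rewrite -exprS prednK.
have -> : y ^+ (k * s) = y ^+ (k * s - k) * y ^+ k.
  by rewrite -exprD subnK // leq_pmulr.
have -> : 1 + e * s%:R / y = (y + e * s%:R) / y by field.
have exprk z : z ^+ k = z * z ^+ k.-1 :> F by rewrite -exprS prednK.
rewrite expr_div_n !exprk -(mulr_natr _ k).
have -> : k%:R = k.-1%:R + 1 :> F by rewrite natr1 prednK.
rewrite -(mulr_natr e) -(mulr_natr (e * x)) -(mulr_natr (e ^+ 2)) !natrM.
have -> : k%:R = k.-1%:R + 1 :> F by rewrite natr1 prednK.
(* Powers and numerals become free variables, so that a purely rational identity is left to
   [field]. *)
move: xp0 ys0 (expf_neq0 k.-1 y0).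
set yk := y ^+ k.-1; set ysk := (_ + _) ^+ k.-1; set yks := y ^+ _; set xp := x ^+ _.
clearbody yk ysk yks xp; move: p%:R s%:R k.-1%:R => P S K' xp0 ys0 yk0.
by field; rewrite ?xp0 ?ys0 ?y0 ?yk0 ?x0.
Qed.

Local Notation "x %:F" := (tofrac x).

(** The determinant formula divides, so it is used in the fraction field of the polynomial ring. Its
    nonvanishing hypotheses hold there for all constants, the quantities being monic of degree one,
    and injectivity of the embedding brings the identity back. *)
Lemma char_poly_multipartite (C : fieldType) n (I : finType) (c : 'I_n -> I)
    (a0 : I) (p k s : nat) (delta : I -> C) (d1 e : C)
    (X0 := 'X - (delta a0)%:P) (X1 := 'X - d1%:P) (ep := e%:P : {poly C}) :
    (0 < p)%N -> (0 < k)%N -> (0 < s)%N ->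
    part_size c a0 = p ->
    (forall a, a != a0 -> part_size c a = 0%N \/ part_size c a = s) ->
    n = (p + k * s)%N ->
    (forall a, a != a0 -> delta a = d1) ->
  char_poly (\matrix_(i, j) ((i == j)%:R * delta (c i) + e * (c i != c j)%:R)) =
  X0 ^+ p.-1 * X1 ^+ (k * s - k) * (X1 + ep *+ s) ^+ k.-1 *
  (X0 * X1 - ep * X0 *+ (k.-1 * s) - ep ^+ 2 *+ (p * (k * s))).
Proof.
move=> p_gt0 k_gt0 s_gt0 size_a0 size_small def_n delta_small.
have cardV : #|'I_n| = (p + k * s)%N by rewrite card_ord.
pose K := {fraction {poly C}}.
pose f a : K := ('X - (delta a)%:P)%:F.
pose E : K := ep%:F.
have epE m : ep *+ m = (e *+ m)%:P by rewrite polyCMn.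
have f_neq0 a : f a != 0 by rewrite /f tofrac_eq0 polyXsubC_eq0.
have fN_neq0 a : f a + E * (part_size c a)%:R != 0.
  rewrite /f /E mulr_natr -tofracMn -tofracD tofrac_eq0 epE.
  by rewrite -addrA -polyCN -polyCD -[_ + _ *+ _]opprK polyCN polyXsubC_eq0.
apply/eqP; rewrite -tofrac_eq; apply/eqP.
rewrite /char_poly -det_map_mx /=.
(* Off the diagonal, [- (c i != c j)] is [(c i == c j) - 1], which vanishes on the diagonal. *)
have -> : map_mx (@tofrac _) (char_poly_mx
      (\matrix_(i, j) ((i == j)%:R * delta (c i) + e * (c i != c j)%:R))) =
    \matrix_(i, j) ((i == j)%:R * f (c i) + E * ((c i == c j)%:R - 1)).
  apply/matrixP=> i j; rewrite !mxE /f /E.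
  rewrite -!tofrac1 -!tofracMn -tofracB -!tofracM -tofracD; congr (_%:F).
  case: (eqVneq i j) => [->|_]; rewrite ?eqxx ?mulr1n ?mulr0n ?mul1r ?mul0r.
    by rewrite mulr0 addr0 subrr mulr0 addr0.
  rewrite sub0r !add0r /ep; case: eqP => _ /=.
    by rewrite mulr0 subrr mulr0 oppr0.
  by rewrite mulr1 sub0r mulrN1.
rewrite (det_multipartite _ _ _ c f E f_neq0 fN_neq0).
have f_small a : a != a0 -> f a = X1%:F by rewrite /f => /delta_small->.
rewrite (prod_parts _ _ c a0 p k s size_a0 cardV _ f X1%:F) //.
rewrite (big_parts _ _ c a0 s size_small); last first.
  by move=> a _; rewrite -/(part_size c a) => ->; rewrite mulr0 mul0r addr0.
rewrite (big_parts _ _ c a0 s size_small); last first.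
  by move=> a _; rewrite -/(part_size c a) => ->; rewrite mul0r.
rewrite -/(part_size c a0) size_a0.
have card_small := card_small_parts _ _ c a0 p k s s_gt0 size_a0 size_small cardV.
rewrite (eq_bigr (fun=> 1 + E * s%:R / X1%:F)); last first.
  by move=> a /andP[/f_small-> /eqP]; rewrite -/(part_size c a) => ->.
rewrite prodr_const card_small (eq_bigr (fun=> s%:R / (X1%:F + E * s%:R))); last first.
  by move=> a /andP[/f_small-> /eqP]; rewrite -/(part_size c a) => ->.
rewrite sumr_const card_small.
have F0_neq0 := f_neq0 a0; have F0p_neq0 := fN_neq0 a0.
have F1_neq0 : X1%:F != 0 by rewrite tofrac_eq0 polyXsubC_eq0.
have F1s_neq0 : X1%:F + E * s%:R != 0.
  rewrite mulr_natr -tofracMn -tofracD tofrac_eq0 epE.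
  by rewrite -addrA -polyCN -polyCD -[_ + _ *+ _]opprK polyCN polyXsubC_eq0.
rewrite size_a0 in F0p_neq0.
have:= multipartite_factor _ _ _ _ p k s p_gt0 k_gt0 s_gt0 F0_neq0 F0p_neq0 F1_neq0 F1s_neq0.
move=> /= ->.
rewrite -[f a0]/(X0%:F) /E.
move: X0 X1 ep {f f_neq0 fN_neq0 f_small E epE
  F0_neq0 F0p_neq0 F1_neq0 F1s_neq0} => Y0 Y1 ep.
by rewrite !(tofracXn, tofracM, tofracB, tofracD, tofracMn).
Qed.

(** * Spectra and energies of complete multipartite graphs *)

(** One distinguished part of size [p] and [k] parts of size [s]; labels in [I]
that no vertex uses are harmless. *)
Definition multipartite (X : sgraph) (p k s : nat) : Prop :=
  exists (I : finType) (c : vertex X -> I) (a0 : I),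
  [/\ forall x y, adj x y = (c x != c y), part_size c a0 = p,
      forall a, a != a0 -> part_size c a = 0%N \/ part_size c a = s
    & #|vertex X| = (p + k * s)%N].

(** Both sides count ordered adjacent pairs: by first vertex, and along [(x, y) |-> [set x; y]],
    whose fibres over edges have two elements because no vertex is adjacent to itself. *)
Lemma sum_degree (X : sgraph) :
  (\sum_(x : vertex X) degree x = 2 * #|edges X|)%N.
Proof.
pose P := [set q : vertex X * vertex X | adj q.1 q.2].
transitivity #|P|.
  rewrite -sum1_card; rewrite (eq_bigl (fun q => adj q.1 q.2)) => [|q]; last by rewrite inE.
  rewrite -(pair_big_dep xpredT (fun x y => adj x y) (fun _ _ => 1%N)) /=.
  by apply: eq_bigr => x _; rewrite /degree cardsE sum1_card.
rewrite -sum1_card (partition_big (fun q => [set q.1; q.2]) (mem (edges X))) /=; last first.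
  by move=> q; rewrite inE => adjq; apply/imsetP; exists q; rewrite ?inE.
rewrite (eq_bigr (fun=> 2%N)) ?sum_nat_const ?(mulnC 2) //.
move=> E /imsetP[[x y]]; rewrite inE /= => adjxy ->{E}.
have x_neq_y : x != y by apply: contraTneq adjxy => ->; rewrite adj_irrefl.
have <- : #|[set (x, y); (y, x)]| = 2%N by rewrite cards2 xpair_eqE (negbTE x_neq_y).
rewrite sum1_card.
apply: eq_card => -[u v]; rewrite !inE unfold_in /= inE /= !xpair_eqE.
apply/idP/idP => [/andP[adjuv /eqP eq_uv]|]; last first.
  by case/orP=> /andP[/eqP-> /eqP->]; rewrite ?[adj y x]adj_sym adjxy 1?setUC eqxx.
have u_neq_v : u != v by apply: contraTneq adjuv => ->; rewrite adj_irrefl.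
have := set21 u v; have := set22 u v; rewrite eq_uv !inE.
by case/orP=> /eqP vE /orP[]/eqP uE; rewrite uE vE !eqxx ?orbT // in u_neq_v *.
Qed.

(** The roots [r1] and [r2] of the quadratic factor enter through their sum and product, so that any
    closed form can be plugged in; an arbitrary [g] serves all three energies. *)
Lemma sum_eigenvalues_multipartite n (I : finType) (c : 'I_n -> I)
    (a0 : I) (p k s : nat) (delta : I -> algC) (d1 e r1 r2 : algC)
    (A : 'M[algC]_n) (g : algC -> algC) :
    (0 < p)%N -> (0 < k)%N -> (0 < s)%N ->
    part_size c a0 = p ->
    (forall a, a != a0 -> part_size c a = 0%N \/ part_size c a = s) ->
    n = (p + k * s)%N ->
    (forall a, a != a0 -> delta a = d1) ->
    A = \matrix_(i, j) ((i == j)%:R * delta (c i) + e * (c i != c j)%:R) ->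
    r1 + r2 = delta a0 + d1 + e * (k.-1 * s)%:R ->
    r1 * r2 = delta a0 * d1 + e * delta a0 * (k.-1 * s)%:R - e ^+ 2 * (p * (k * s))%:R ->
  \sum_(z <- eigenvalues A) g z =
    g (delta a0) *+ p.-1 + g d1 *+ (k * s - k) + g (d1 - e *+ s) *+ k.-1 + (g r1 + g r2).
Proof.
move=> p_gt0 k_gt0 s_gt0 size_a0 size_small def_n delta_small defA sum_r prod_r.
pose L := nseq p.-1 (delta a0) ++ nseq (k * s - k) d1 ++ nseq k.-1 (d1 - e *+ s) ++ [:: r1; r2].
have prod_nseq m (z : algC) : \prod_(x <- nseq m z) ('X - x%:P) = ('X - z%:P) ^+ m.
  by rewrite big_nseq -Monoid.iteropE.
have eigA : perm_eq (eigenvalues A) L.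
  apply: prod_XsubC_eq; rewrite -eigenvaluesE defA.
  rewrite (char_poly_multipartite _ _ _ _ a0 p k s _ d1) //.
  rewrite !big_cat /= !prod_nseq big_cons big_seq1 -!mulrA; congr (_ * (_ * (_ * _))).
    by congr (_ ^+ _); rewrite polyCB polyCMn opprB addrA addrAC.
  have -> : ('X - r1%:P) * ('X - r2%:P) = 'X ^+ 2 - (r1 + r2)%:P * 'X + (r1 * r2)%:P.
    by rewrite polyCD polyCM; ring.
  rewrite sum_r prod_r !(polyC_exp, polyCD, polyCB, polyCM, polyC_natr).
  by rewrite -[_ *+ (k.-1 * s)]mulr_natr -[_ *+ (p * _)]mulr_natr; ring.
rewrite (perm_big _ eigA) /= !big_cat /= !big_nseq big_cons big_seq1 !iter_addr_0.
by rewrite !addrA.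
Qed.

Section MultipartiteGraph.

Variables (X : sgraph) (p k s : nat).
Hypotheses (p_gt0 : (0 < p)%N) (k_gt0 : (0 < k)%N) (s_gt0 : (0 < s)%N).
Hypothesis X_multi : multipartite X p k s.

Lemma order_multipartite : order_of X = (p + k * s)%N.
Proof. by case: X_multi => I [c] [a0] []. Qed.

Lemma degree_part (I : finType) (c : vertex X -> I) x :
  (forall x y, adj x y = (c x != c y)) -> degree x = (order_of X - part_size c (c x))%N.
Proof.
move=> adjE; apply/eqP; rewrite -(eqn_add2r (part_size c (c x))) subnK; last first.
  exact: max_card.
apply/eqP; rewrite addnC /order_of -(cardC [pred y | c y == c x]) /part_size; congr (_ + _)%N.
by rewrite /degree cardsE; apply: eq_card => y; rewrite !inE -topredE /= adjE eq_sym.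
Qed.

(** By the degree sum: [p] vertices have degree [k * s], the other [k * s] have degree
    [p + k.-1 * s]. *)
Lemma average_degree_multipartite :
  average_degree X = (k * s * (2 * p + k.-1 * s))%:R / (p + k * s)%:R.
Proof.
case: X_multi => I [c] [a0] [adjE size_a0 size_small cardV].
rewrite /average_degree order_multipartite -sum_degree; congr (_%:R / _).
rewrite (bigID [pred x | c x == a0]) /=.
rewrite (eq_bigr (fun=> k * s)%N) => [|x /eqP cx]; last first.
  by rewrite (degree_part _ c) // cx size_a0 order_multipartite addKn.
rewrite [X in (_ + X)%N](eq_bigr (fun=> p + k.-1 * s)%N) => [|x cx]; last first.
  (* The part of [x] contains [x], which excludes size 0. *)
  rewrite (degree_part _ c) // order_multipartite; case: (size_small _ cx) => [/eqP|->].
    by rewrite -leqn0 leqNgt => /negP[]; apply/card_gt0P; exists x; rewrite inE.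
  by rewrite -[in LHS](prednK k_gt0) mulSn addnCA addKn.
have := cardC [pred x | c x == a0]; rewrite cardV -/(part_size c a0) size_a0 => /addnI cardC.
rewrite !sum_nat_const -/(part_size c a0) size_a0.
have -> : #|[pred x | c x != a0]| = (k * s)%N by rewrite -cardC; apply: eq_card.
lia.
Qed.

(** The pairs [(w, e)] equal to [(0, 1)], [(1, -1)] and [(1, 1)] give the adjacency matrix, the
    Laplacian and the signless Laplacian. *)
Lemma sum_eigenvalues_degmx_adjmx (w e r1 r2 : algC) (A : 'M_(order_of X))
    (d0 := w * (k * s)%:R) (d1 := w * (p + k.-1 * s)%:R) (g : algC -> algC) :
    A = w *: degmx X + e *: adjmx X ->
    r1 + r2 = d0 + d1 + e * (k.-1 * s)%:R ->
    r1 * r2 = d0 * d1 + e * d0 * (k.-1 * s)%:R - e ^+ 2 * (p * (k * s))%:R ->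
  \sum_(z <- eigenvalues A) g z =
    g d0 *+ p.-1 + g d1 *+ (k * s - k) + g (d1 - e *+ s) *+ k.-1 + (g r1 + g r2).
Proof.
move=> defA sum_r prod_r.
case: X_multi => I [c] [a0] [adjE size_a0 size_small cardV].
pose c' (i : 'I_(order_of X)) := c (enum_val i).
have part_sizeE a : part_size c' a = part_size c a.
  rewrite /part_size -!sum1_card [RHS](reindex (@enum_val _ (vertex X))) //=.
  by apply: onW_bij; exact: enum_val_bij.
pose delta a : algC := if a == a0 then d0 else d1.
rewrite (sum_eigenvalues_multipartite _ _ c' a0 p k s delta d1 e r1 r2) //.
- by rewrite /delta eqxx.
- by rewrite part_sizeE.
- by move=> a /size_small; rewrite part_sizeE.
- by move=> a /negbTE; rewrite /delta => ->.
- rewrite defA; apply/matrixP=> i j; rewrite !mxE adjE; congr (_ + _).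
  case: eqP => _; last by rewrite mulr0n mulr0 mul0r.
  rewrite mulr1n mul1r (degree_part _ c) // order_multipartite /delta.
  have [cx|cx] := eqVneq (c' i) a0; first by rewrite /c' in cx; rewrite cx size_a0 addKn.
  case: (size_small _ cx) => [/eqP|->].
    by rewrite -leqn0 leqNgt => /negP[]; apply/card_gt0P; exists (enum_val i); rewrite inE.
  by rewrite -[in LHS](prednK k_gt0) mulSn addnCA addKn.
- by rewrite /delta eqxx.
- by rewrite /delta eqxx.
Qed.

Lemma energy_multipartite (r1 r2 : algC) :
    r1 + r2 = (k.-1 * s)%:R -> r1 * r2 = - (p * (k * s))%:R ->
  energy X = s%:R *+ k.-1 + (`|r1| + `|r2|).
Proof.
move=> sum_r prod_r; rewrite /energy (sum_eigenvalues_degmx_adjmx 0 1 r1 r2).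
- by rewrite !mul0r !normr0 !mul0rn !add0r normrN normr_nat.
- by rewrite scale0r add0r scale1r.
- by rewrite !mul0r !add0r mul1r.
- by rewrite prod_r !mul0r mulr0 mul0r expr1n mul1r !add0r.
Qed.

Let d := average_degree X.
Let d0 : algC := (k * s)%:R.
Let d1 : algC := (p + k.-1 * s)%:R.

(** Here the quadratic factor has the roots [p + k * s] and 0. The first equals [d1 + s], whence the
    multiplicity [k]; the second gives the norm of [d]. *)
Lemma L_energy_multipartite :
  L_energy X = `|d0 - d| *+ p.-1 + `|d1 - d| *+ (k * s - k)
     + `|(p + k * s)%:R - d| *+ k + `|d|.
Proof.
rewrite /L_energy (sum_eigenvalues_degmx_adjmx 1 (-1) (p + k * s)%:R 0).
- rewrite !mul1r sub0r normrN -/d0 -/d1 -/d mulNrn opprK.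
  have -> : d1 + s%:R = (p + k * s)%:R by rewrite -natrD -[in RHS](prednK k_gt0); congr _%:R; lia.
  have -> (z : algC) : z *+ k = z *+ k.-1 + z by rewrite -mulrSr prednK.
  by rewrite !addrA.
- by rewrite scale1r scaleN1r.
- by rewrite !mul1r mulN1r addr0 !natrD; ring.
- rewrite mulr0 !mul1r mulN1r sqrrN expr1n mul1r.
  by rewrite !natrM !natrD !natrM; ring.
Qed.

Lemma Q_energy_multipartite (r1 r2 : algC) :
    r1 + r2 = d0 + d1 + (k.-1 * s)%:R ->
    r1 * r2 = d0 * d1 + d0 * (k.-1 * s)%:R - (p * (k * s))%:R ->
  Q_energy X = `|d0 - d| *+ p.-1 + `|d1 - d| *+ (k * s - k)
     + `|d1 - s%:R - d| *+ k.-1 + (`|r1 - d| + `|r2 - d|).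
Proof.
move=> sum_r prod_r.
rewrite /Q_energy (sum_eigenvalues_degmx_adjmx 1 1 r1 r2) ?scale1r ?mul1r ?expr1n //.
by rewrite mul1r.
Qed.

End MultipartiteGraph.

(** * Energies of complete graphs, whose parts are singletons *)

Lemma multipartite_complete n : multipartite (complete_graph n.+1) 1 n 1.
Proof.
exists 'I_n.+1, id, ord0; split=> // [|a _|]; last by rewrite card_ord muln1.
  by rewrite /part_size (eq_card1 (x := ord0)).
by right; rewrite /part_size (eq_card1 (x := a)).
Qed.

Lemma average_degree_complete n : (0 < n)%N ->
  average_degree (complete_graph n.+1) = n%:R.
Proof.
move=> n_gt0; rewrite (average_degree_multipartite _ 1 n 1) //; last exact: multipartite_complete.
have -> : (2 * 1 + n.-1 * 1 = 1 + n * 1)%N by lia.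
by rewrite natrM muln1 mulfK // pnatr_eq0.
Qed.

Lemma energy_complete n : (0 < n)%N -> energy (complete_graph n.+1) = (2 * n)%:R.
Proof.
move=> n_gt0.
have eqn : n%:R = n.-1%:R + 1 :> algC by rewrite natr1 prednK.
(* The quadratic factor is [(x - n) (x + 1)]. *)
rewrite (energy_multipartite _ 1 n 1 _ _ _ (multipartite_complete n) n%:R (-1)) //.
- by rewrite normrN1 normr_nat natrM eqn; ring.
- by rewrite muln1 eqn; ring.
- by rewrite mulrN1 mul1n muln1.
Qed.

Lemma L_energy_complete n : (0 < n)%N -> L_energy (complete_graph n.+1) = (2 * n)%:R.
Proof.
move=> n_gt0.
rewrite (L_energy_multipartite _ 1 n 1) ?average_degree_complete //;
  last exact: multipartite_complete.
rewrite !muln1 subnn /= !mulr0n !add0r [(1 + n)%:R]natrD addrK normr1 normr_nat.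
by rewrite mul2n -addnn natrD.
Qed.

Lemma Q_energy_complete n : (0 < n)%N -> Q_energy (complete_graph n.+1) = (2 * n)%:R.
Proof.
move=> n_gt0.
have eqn : n%:R = n.-1%:R + 1 :> algC by rewrite natr1 prednK.
(* The quadratic factor is [(x - 2 n) (x - (n - 1))]. *)
rewrite (Q_energy_multipartite _ 1 n 1 _ _ _ (multipartite_complete n) (2 * n)%:R (n.-1)%:R) //.
- rewrite average_degree_complete // !muln1 subnn !mulr0n !add0r natrD.
  have -> : 1%:R + n.-1%:R - 1%:R - n%:R = -1 :> algC by rewrite eqn; ring.
  have -> : n.-1%:R - n%:R = -1 :> algC by rewrite eqn; ring.
  have -> : (2 * n)%:R - n%:R = n%:R :> algC by rewrite natrM; ring.
  by rewrite normrN1 normr_nat natrM eqn; ring.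
- by rewrite !muln1 natrM natrD eqn; ring.
- by rewrite !muln1 mul1n natrM natrD eqn; ring.
Qed.

(** * Closed forms for one part of size [s * t] and [t + 1] parts of size [s] *)

Section DihedralType.

Variables (X : sgraph) (s t : nat).
Hypotheses (s_gt0 : (0 < s)%N) (t_gt0 : (0 < t)%N).
Hypothesis X_multi : multipartite X (s * t) t.+1 s.

(** Computations take place in [algR], where the order is total, and pass to [algC] through
    [algRval]. Up to the factor [s ^ 2], the squares of [r5] and [r8] are the discriminants of the
    quadratic factors for the adjacency matrix and the signless Laplacian. *)
Variables S T r5 r8 : algR.
Hypotheses (S_def : s%:R = S) (T_def : t%:R = T).
Hypotheses (r5_ge0 : 0 <= r5) (r5_sqr : r5 ^+ 2 = 5 * T ^+ 2 + 4 * T).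
Hypotheses (r8_ge0 : 0 <= r8) (r8_sqr : r8 ^+ 2 = 8 * T ^+ 2 + 1).

Let algRval_nat (n : nat) : n%:R = algRval n%:R.
Proof. by rewrite rmorph_nat. Qed.

Let T_ge1 : 1 <= T. Proof. by rewrite -T_def ler1n. Qed.
Let S_ge1 : 1 <= S. Proof. by rewrite -S_def ler1n. Qed.
Let st_gt0 : (0 < s * t)%N. Proof. by rewrite muln_gt0 s_gt0. Qed.

Let T_le_r5 : T <= r5.
Proof.
rewrite -(@ler_pXn2r _ 2) ?nnegrE //; last by have T1 := T_ge1; lra.
by rewrite r5_sqr; have T1 := T_ge1; nra.
Qed.

(** The constant lies just below the square root of 8; the bound serves to place the average degree
    between the two signless Laplacian roots. *)
Let r8_ge : 14 / 5 * T <= r8.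
Proof.
rewrite -(@ler_pXn2r _ 2) ?nnegrE //; last by have T1 := T_ge1; lra.
by rewrite r8_sqr; have T1 := T_ge1; nra.
Qed.

(** The roots [S * (T + r5) / 2] and [S * (T - r5) / 2] have opposite signs, so their norms add up
    to [S * r5]; the eigenvalue [- s], of multiplicity [t], adds [S * T]. *)
Lemma energy_dihedral_type : energy X = algRval (S * (T + r5)).
Proof.
rewrite (energy_multipartite _ _ _ _ st_gt0 _ _ X_multi
   (algRval (S * (T + r5) / 2)) (algRval (S * (T - r5) / 2))) //.
- have -> : `|algRval (S * (T + r5) / 2)| = algRval `|S * (T + r5) / 2| by [].
  have -> : `|algRval (S * (T - r5) / 2)| = algRval `|S * (T - r5) / 2| by [].
  rewrite algRval_nat -rmorphMn -!(rmorphD algRval); congr algRval.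
  have := T_ge1; have := S_ge1; have := T_le_r5 => r5T S1 T1.
  rewrite ger0_norm; last by nra.
  rewrite ler0_norm; last by nra.
  by rewrite -mulr_natr S_def /= T_def; field.
- rewrite algRval_nat -!(rmorphD algRval); congr algRval.
  by rewrite /= natrM S_def T_def; field.
- rewrite algRval_nat -(rmorphM algRval) -(rmorphN algRval); congr algRval.
  rewrite !natrM -[t.+1%:R]natr1 S_def T_def.
  have -> : S * (T + r5) / 2 * (S * (T - r5) / 2) = S ^+ 2 * (T ^+ 2 - r5 ^+ 2) / 4 by field.
  by rewrite r5_sqr; field.
Qed.

Local Notation d := (3 * S * T * (T + 1) / (2 * T + 1)).

Let T21_neq0 : 2 * T + 1 != 0.
Proof. by have := T_ge1 => T1; apply/eqP => T0; lra. Qed.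

Lemma average_degree_dihedral_type : average_degree X = algRval d.
Proof.
rewrite (average_degree_multipartite _ _ _ _ _ _ _ X_multi) //.
rewrite !algRval_nat -fmorph_div; congr algRval.
rewrite /= !natrM !natrD !natrM -[t.+1%:R]natr1 S_def T_def.
have := T_ge1; have := S_ge1 => S1 T1.
by field; rewrite T21_neq0 /=; apply/eqP=> H; nra.
Qed.

Let predST : (s * t).-1%:R = S * T - 1.
Proof. by rewrite -S_def -T_def -natrM -[in RHS](prednK st_gt0) -natr1 addrK. Qed.

Let predS : (t.+1 * s - t.+1)%:R = (T + 1) * (S - 1).
Proof.
by rewrite natrB ?leq_pmulr // natrM -[t.+1%:R]natr1 T_def S_def; ring.
Qed.

Let norm_nonneg_frac (a x : algR) : 0 <= a -> a = x -> `|x| = a.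
Proof. by move=> a0 <-; rewrite ger0_norm. Qed.

Let T21_gt0 : 0 < 2 * T + 1. Proof. by have T1 := T_ge1; lra. Qed.

(** [1 <= T] fixes the signs here and in [norm_d1]: degrees in the distinguished part are at most
    the average, the others at least. *)
Let norm_d0 : `|(t.+1 * s)%:R - d| = S * (T + 1) * (T - 1) / (2 * T + 1).
Proof.
rewrite -normrN; apply: norm_nonneg_frac.
  have := T_ge1; have := S_ge1 => S1 T1.
  by rewrite divr_ge0 ?(ltW T21_gt0) ?mulr_ge0 //; lra.
by rewrite natrM -[t.+1%:R]natr1 T_def S_def; field.
Qed.

Let norm_d1 : `|(s * t + t * s)%:R - d| = S * T * (T - 1) / (2 * T + 1).
Proof.
apply: norm_nonneg_frac.
  have := T_ge1; have := S_ge1 => S1 T1.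
  by rewrite divr_ge0 ?(ltW T21_gt0) ?mulr_ge0 //; lra.
by rewrite natrD !natrM T_def S_def; field.
Qed.

Lemma L_energy_dihedral_type :
  L_energy X = algRval (2 * S * (T + 1) * (3 * T + (S * T - 1) * (T - 1)) / (2 * T + 1)).
Proof.
rewrite (L_energy_multipartite _ _ _ _ _ _ _ X_multi) // average_degree_dihedral_type.
rewrite !algRval_nat -!(rmorphB algRval).
have normE x : `|algRval x| = algRval `|x| by [].
rewrite !normE -!rmorphMn -!(rmorphD algRval); congr algRval.
rewrite -!(mulr_natr `|_|) /= norm_d0 norm_d1 predST predS.
have := T_ge1; have := S_ge1 => S1 T1.
have -> : `|d| = d by rewrite ger0_norm // divr_ge0 ?(ltW T21_gt0) ?mulr_ge0 //; lra.
have -> : `|(s * t + t.+1 * s)%:R - d| = S * (T ^+ 2 + T + 1) / (2 * T + 1).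
  apply: norm_nonneg_frac; first by rewrite divr_ge0 ?(ltW T21_gt0) ?mulr_ge0 //; nra.
  by rewrite natrD !natrM -[t.+1%:R]natr1 T_def S_def; field.
by rewrite -[t.+1%:R]natr1 T_def; field.
Qed.

(** The average degree separates the two roots, so their terms add up to [S * r8]. One absolute
    value stays, as [T ^ 2 - 3 * T - 1] changes sign between [T = 3] and [T = 4]. *)
Lemma Q_energy_dihedral_type :
  Q_energy X = algRval (S * (((S * T - 1) * (T + 1) * (T - 1)
    + (T + 1) * (S - 1) * T * (T - 1) + T * `|T ^+ 2 - 3 * T - 1|) / (2 * T + 1) + r8)).
Proof.
rewrite (Q_energy_multipartite _ _ _ _ _ _ _ X_multi (algRval (S * (4 * T + 1 + r8) / 2))
  (algRval (S * (4 * T + 1 - r8) / 2))) //; last 2 first.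
- rewrite !algRval_nat -!(rmorphD algRval); congr algRval.
  by rewrite /= natrD !natrM -[t.+1%:R]natr1 T_def S_def; field.
- rewrite !algRval_nat -!(rmorphM algRval) -!(rmorphD algRval) -(rmorphB algRval); congr algRval.
  have -> : S * (4 * T + 1 + r8) / 2 * (S * (4 * T + 1 - r8) / 2) =
      S ^+ 2 * ((4 * T + 1) ^+ 2 - r8 ^+ 2) / 4 by field.
  by rewrite r8_sqr /= natrD !natrM -[t.+1%:R]natr1 T_def S_def; field.
rewrite average_degree_dihedral_type !algRval_nat -!(rmorphB algRval).
have normE x : `|algRval x| = algRval `|x| by [].
rewrite !normE -!rmorphMn -!(rmorphD algRval); congr algRval.
rewrite -!(mulr_natr `|_|) /= norm_d0 norm_d1 predST predS.
have := T_ge1; have := S_ge1; have := r8_ge => r814 S1 T1.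
have -> : `|(s * t + t * s)%:R - s%:R - d| = S * `|T ^+ 2 - 3 * T - 1| / (2 * T + 1).
  rewrite -[in RHS](ger0_norm (ltW T21_gt0)) -[X in _ = X * _ / _]ger0_norm ?(le_trans ler01) //.
  rewrite -normfV -!normrM; congr `|_|.
  by rewrite natrD !natrM T_def S_def; field.
have -> : `|S * (4 * T + 1 + r8) / 2 - d| = S * (4 * T + 1 + r8) / 2 - d.
  rewrite ger0_norm // subr_ge0 ler_pdivrMr //.
  (* The factor [S] is put back only afterwards, so [nra] faces [T] and [r8] alone. *)
  have h : 6 * T * (T + 1) <= (4 * T + 1 + r8) * (2 * T + 1) by nra.
  have S0 : 0 <= S by lra.
  by have := ler_wpM2l S0 h; lra.
have -> : `|S * (4 * T + 1 - r8) / 2 - d| = d - S * (4 * T + 1 - r8) / 2.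
  rewrite ler0_norm ?opprB // subr_le0 ler_pdivlMr //.
  have h : (4 * T + 1 - r8) * (2 * T + 1) <= 6 * T * (T + 1) by nra.
  have S0 : 0 <= S by lra.
  by have := ler_wpM2l S0 h; lra.
by rewrite T_def; field.
Qed.

End DihedralType.

(** * Comparison of the three energies *)

Lemma sqrt_bounds (R : realFieldType) (T r5 r8 : R) :
    2 <= T -> 0 <= r5 -> r5 ^+ 2 = 5 * T ^+ 2 + 4 * T ->
    0 <= r8 -> r8 ^+ 2 = 8 * T ^+ 2 + 1 ->
  [/\ 2 * T + 1 <= r5, r5 <= 9 / 4 * T + 9 / 10, 14 / 5 * T <= r8 & r8 <= 3 * T].
Proof.
move=> T2 r5_ge0 r5_sqr r8_ge0 r8_sqr.
have sq_le (x y : R) : 0 <= x -> 0 <= y -> x ^+ 2 <= y ^+ 2 -> x <= y.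
  by move=> x0 y0; rewrite ler_pXn2r ?nnegrE.
(* [9 / 4] exceeds the square root of 5, and [14 / 5] is below that of 8; [9 / 10] covers the linear
   term, as [2 * (9 / 4) * (9 / 10)] exceeds 4. *)
by split; apply: sq_le; rewrite ?r5_sqr ?r8_sqr //; nra.
Qed.

Section RealComparison.

Variables (R : realFieldType) (S T r5 r8 E Q L : R).
Hypotheses (r5_ge0 : 0 <= r5) (r5_sqr : r5 ^+ 2 = 5 * T ^+ 2 + 4 * T).
Hypotheses (r8_ge0 : 0 <= r8) (r8_sqr : r8 ^+ 2 = 8 * T ^+ 2 + 1).
Hypothesis E_def : E = S * (T + r5).
Hypothesis Q_def : Q = S * (((S * T - 1) * (T + 1) * (T - 1)
    + (T + 1) * (S - 1) * T * (T - 1) + T * `|T ^+ 2 - 3 * T - 1|) / (2 * T + 1) + r8).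
Hypothesis L_def : L = 2 * S * (T + 1) * (3 * T + (S * T - 1) * (T - 1)) / (2 * T + 1).

(** [S * (2 * T + 1)] is the number of vertices, and the upper bound is the energy of the complete
    graph on as many vertices. *)
Lemma energy_bounds : S = 1 \/ S = 2 -> 2 <= T ->
  S * (2 * T + 1) <= E <= 2 * (S * (2 * T + 1) - 1).
Proof.
move=> S12 T2; have [r5l r5u _ _] := sqrt_bounds _ _ _ _ T2 r5_ge0 r5_sqr r8_ge0 r8_sqr.
by rewrite E_def; case: S12 => ->; apply/andP; split; lra.
Qed.

Lemma L_energy_gt : S = 1 \/ S = 2 -> 2 <= T -> 2 * (S * (2 * T + 1) - 1) < L.
Proof.
move=> S12 T2; rewrite L_def ltr_pdivlMr; last by lra.
case: S12 => ->.
  suff : 0 < 2 * (T + 1) * (3 * T + (T - 1) ^+ 2) - 4 * T * (2 * T + 1) by lra.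
  nra.
nra.
Qed.

Lemma energies_lt_large : S = 1 \/ S = 2 -> 4 <= T ->
  [/\ E < Q, Q < L & 2 * (S * (2 * T + 1) - 1) < Q].
Proof.
move=> S12 T4; have T2 : 2 <= T by lra.
have [r5l r5u r8l r8u] := sqrt_bounds _ _ _ _ T2 r5_ge0 r5_sqr r8_ge0 r8_sqr.
have D_gt0 : 0 < 2 * T + 1 by lra.
have absE : `|T ^+ 2 - 3 * T - 1| = T ^+ 2 - 3 * T - 1 by rewrite ger0_norm //; nra.
(* After the shift to [u] and multiplication by [2 * T + 1], [lra] can treat the powers of [u] as
   nonnegative atoms, and the products of [u] with [r5] and [r8] as further atoms bounded by [h1],
   [h2] and [h3]. *)
pose u := T - 4; have u0 : 0 <= u by rewrite subr_ge0.
have u2 : 0 <= u ^+ 2 by rewrite exprn_ge0.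
have u3 : 0 <= u ^+ 3 by rewrite exprn_ge0.
have defT : T = 4 + u by rewrite /u; lra.
clearbody u.
have QD : Q * (2 * T + 1) = S * ((S * T - 1) * (T + 1) * (T - 1)
    + (T + 1) * (S - 1) * T * (T - 1) + T * (T ^+ 2 - 3 * T - 1) + r8 * (2 * T + 1)).
  by rewrite Q_def absE; field; rewrite gt_eqF.
have LD : L * (2 * T + 1) = 2 * S * (T + 1) * (3 * T + (S * T - 1) * (T - 1)).
  by rewrite L_def divfK // gt_eqF.
have h1 : 14 / 5 * T * (2 * T + 1) <= r8 * (2 * T + 1) by rewrite ler_pM2r.
have h2 : r8 * (2 * T + 1) <= 3 * T * (2 * T + 1) by rewrite ler_pM2r.
have h3 : r5 * (2 * T + 1) <= (9 / 4 * T + 9 / 10) * (2 * T + 1) by rewrite ler_pM2r.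
split; rewrite -(@ltr_pM2r _ (2 * T + 1)) // ?QD ?LD ?E_def;
  move: h1 h2 h3; rewrite defT; case: S12 => -> *; lra.
Qed.

Lemma energies_lt_T2 : S = 1 \/ S = 2 -> T = 2 -> E < Q /\ Q < L.
Proof.
move=> S12 defT; have T2 : 2 <= T by lra.
have [r5l r5u r8l r8u] := sqrt_bounds _ _ _ _ T2 r5_ge0 r5_sqr r8_ge0 r8_sqr.
(* For [S = 1] the bounds [r5 <= 27 / 5] and [28 / 5 <= r8] yield only [E <= 37 / 5 <= Q];
   strictness needs a sharper bound. *)
have r8l' : 57 / 10 < r8 by have := r8_sqr; rewrite defT => r8q; nra.
have absE : `|T ^+ 2 - 3 * T - 1| = 3 by rewrite ler0_norm defT; lra.
have D : 2 * T + 1 = 5 by lra.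
by rewrite E_def Q_def L_def absE D defT; rewrite defT in r5u r8u; case: S12 => ->; split; lra.
Qed.

(** The thresholds 26, 8 and 18 in this lemma and the next two are the energies of the complete
    graphs on 14, 5 and 10 vertices, for the dihedral groups of orders 16, 6 and 12. *)
Lemma energies_lt_T3 : S = 2 -> T = 3 -> [/\ E < Q, Q < L & 26 < Q].
Proof.
move=> defS defT; have T2 : 2 <= T by lra.
have [r5l r5u r8l r8u] := sqrt_bounds _ _ _ _ T2 r5_ge0 r5_sqr r8_ge0 r8_sqr.
have absE : `|T ^+ 2 - 3 * T - 1| = 1 by rewrite ler0_norm defT; lra.
have D : 2 * T + 1 = 7 by lra.
by rewrite E_def Q_def L_def absE D defS defT; rewrite defT in r5u r8u r8l; split; lra.
Qed.

Lemma Q_energy_S1_T2 : S = 1 -> T = 2 -> Q <= 8.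
Proof.
move=> defS defT; have T2 : 2 <= T by lra.
have [r5l r5u r8l r8u] := sqrt_bounds _ _ _ _ T2 r5_ge0 r5_sqr r8_ge0 r8_sqr.
have absE : `|T ^+ 2 - 3 * T - 1| = 3 by rewrite ler0_norm defT; lra.
have D : 2 * T + 1 = 5 by lra.
by rewrite Q_def absE D defS defT; rewrite defT in r8u; lra.
Qed.

Lemma Q_energy_S2_T2 : S = 2 -> T = 2 -> 18 < Q.
Proof.
move=> defS defT; have T2 : 2 <= T by lra.
have [r5l r5u r8l r8u] := sqrt_bounds _ _ _ _ T2 r5_ge0 r5_sqr r8_ge0 r8_sqr.
have absE : `|T ^+ 2 - 3 * T - 1| = 3 by rewrite ler0_norm defT; lra.
have D : 2 * T + 1 = 5 by lra.
by rewrite Q_def absE D defS defT; rewrite defT in r8l; lra.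
Qed.

(** Both radicands equal 9. The graph is the octahedron [K_(2,2,2)], coming from [D_8]. *)
Lemma energies_S2_T1 : S = 2 -> T = 1 -> [/\ E = 8, Q = 8 & L = 8].
Proof.
move=> defS defT.
have sqr9 (x : R) : 0 <= x -> x ^+ 2 = 9 -> x = 3.
  by move=> x0 x9; apply/eqP; rewrite -(@eqrXn2 _ 2) // x9; apply/eqP; lra.
have r5E : r5 = 3 by apply: sqr9; rewrite // r5_sqr defT; lra.
have r8E : r8 = 3 by apply: sqr9; rewrite // r8_sqr defT; lra.
have absE : `|T ^+ 2 - 3 * T - 1| = 3 by rewrite ler0_norm defT; lra.
have D : 2 * T + 1 = 3 by lra.
by rewrite E_def Q_def L_def absE D r5E r8E defS defT; split; lra.
Qed.

End RealComparison.

(** The small pairs [(s, t)] in the last hypothesis belong to [m = 3, 4, 6, 8] and are settled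
    numerically; from [t = 4] on the estimates are uniform. *)
Lemma energy_comparison (X : sgraph) (m s t : nat) :
    multipartite X (s * t) t.+1 s -> m = (s * t.+1)%N ->
    [\/ s = 1%N /\ t = 2%N, s = 2%N /\ (1 <= t <= 3)%N | (s = 1%N \/ s = 2%N) /\ (4 <= t)%N] ->
  [/\ [/\ energy X <= Q_energy X,
          Q_energy X <= L_energy X,
          energy X = Q_energy X <-> m = 4%N
        & Q_energy X = L_energy X <-> m = 4%N],
      ~ hypoenergetic X /\ ~ hyperenergetic X
    & [/\ m = 3%N -> L_hyperenergetic X /\ ~ Q_hyperenergetic X,
          m = 4%N -> ~ L_hyperenergetic X /\ ~ Q_hyperenergetic X
        & m <> 3%N -> m <> 4%N ->
          Q_hyperenergetic X /\ L_hyperenergetic X]].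
Proof.
move=> X_multi def_m cases.
have s12 : s = 1%N \/ s = 2%N by case: cases => [[->]|[->]|[]]; auto.
have s_gt0 : (0 < s)%N by case: s12 => ->.
have t_gt0 : (0 < t)%N by case: cases => [[_ ->]|[_ /andP[]]|[_]] //; lia.
have D8_or : (s = 2 /\ t = 1)%N \/ (m != 4 /\ 2 <= t)%N.
  by case: cases def_m => [[-> ->]|[->]|[[]->]]; lia.
have s_small : (t < 4)%N -> m <> 3%N -> s = 2%N by case: cases def_m => [[-> ->]|[->]|[[]->]]; lia.
have m3_cases : m = 3%N -> s = 1%N /\ t = 2%N by case: cases def_m => [[-> ->]|[->]|[[]->]]; lia.
have t3_s2 : t = 3%N -> s = 2%N by case: cases def_m => [[-> ->]|[->]|[[]->]]; lia.
have t_23 : (2 <= t)%N -> (t < 4)%N -> t = 2%N \/ t = 3%N by (clear X_multi; lia).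
(* The order of the graph is [n.+1], the form in which complete graphs were treated. *)
pose n := (s * (2 * t + 1)).-1.
have n_gt0 : (0 < n)%N by rewrite /n; case: s12 => ->; lia.
have n_succ : (s * (2 * t + 1))%N = n.+1 by rewrite /n; case: s12 => ->; lia.
have order_n : (s * t + t.+1 * s)%N = n.+1 by rewrite -n_succ; case: s12 => ->; lia.
pose T : algR := t%:R; pose S : algR := s%:R.
have S12 : S = 1 \/ S = 2 by rewrite /S; case: s12 => ->; auto.
pose r5 := Num.sqrt (5 * T ^+ 2 + 4 * T); pose r8 := Num.sqrt (8 * T ^+ 2 + 1).
have T_ge0 : 0 <= T by exact: ler0n.
have r5_sqr : r5 ^+ 2 = 5 * T ^+ 2 + 4 * T.
  by rewrite sqr_sqrtr // addr_ge0 // mulr_ge0 ?exprn_ge0.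
have r8_sqr : r8 ^+ 2 = 8 * T ^+ 2 + 1.
  by rewrite sqr_sqrtr // addr_ge0 // mulr_ge0 ?exprn_ge0.
have r5_ge0 : 0 <= r5 := sqrtr_ge0 _; have r8_ge0 : 0 <= r8 := sqrtr_ge0 _.
have order_X : order_of X = n.+1 by rewrite (order_multipartite _ _ _ _ X_multi).
have n2E : (2 * n)%:R = algRval (2 * (S * (2 * T + 1) - 1)).
  rewrite -(rmorph_nat algRval); congr algRval; rewrite natrM.
  have -> : n%:R = n.+1%:R - 1 :> algR by rewrite -natr1 addrK.
  by rewrite -n_succ natrM natrD natrM.
have order_E : (order_of X)%:R = algRval (S * (2 * T + 1)).
  rewrite order_X -(rmorph_nat algRval); congr algRval.
  by rewrite -n_succ natrM natrD natrM.
rewrite /hyperenergetic /hypoenergetic /Q_hyperenergetic /L_hyperenergetic.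
rewrite order_E order_X energy_complete // L_energy_complete // Q_energy_complete // n2E.
rewrite (energy_dihedral_type X s t s_gt0 t_gt0 X_multi S T r5) //.
rewrite (L_energy_dihedral_type X s t s_gt0 t_gt0 X_multi S T) //.
rewrite (Q_energy_dihedral_type X s t s_gt0 t_gt0 X_multi S T r8) //.
set E := S * (T + r5); set Q := S * (_ / _ + r8); set L := 2 * S * _ * _ / _.
have lt_val (x y : algR) : (algRval x < algRval y) = (x < y) by [].
have not_lt (x y : algR) : y <= x -> ~ algRval x < algRval y.
  by rewrite lt_val => y_le_x /(le_lt_trans y_le_x); rewrite ltxx.
have bounds := energy_bounds _ S T r5 r8 E r5_ge0 r5_sqr r8_ge0 r8_sqr erefl S12.
have L_gt := L_energy_gt _ S T L erefl S12.
have large := energies_lt_large _ S T r5 r8 E Q L r5_ge0 r5_sqr r8_ge0 r8_sqr erefl erefl erefl S12.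
have lt_T2 := energies_lt_T2 _ S T r5 r8 E Q L r5_ge0 r5_sqr r8_ge0 r8_sqr erefl erefl erefl S12.
have lt_T3 := energies_lt_T3 _ S T r5 r8 E Q L r5_ge0 r5_sqr r8_ge0 r8_sqr erefl erefl erefl.
have Q12 := Q_energy_S1_T2 _ S T r5 r8 Q r5_ge0 r5_sqr r8_ge0 r8_sqr erefl.
have Q22 := Q_energy_S2_T2 _ S T r5 r8 Q r5_ge0 r5_sqr r8_ge0 r8_sqr erefl.
have all21 := energies_S2_T1 _ S T r5 r8 E Q L r5_ge0 r5_sqr r8_ge0 r8_sqr erefl erefl erefl.
have [[s2 t1]|[m_neq4 t_ge2]] := D8_or.
  (* For [D_8] all three energies are 8, between the 6 vertices and the energy 10 of [K_6]. *)
  have [//|//| -> -> ->] := all21; rewrite /S /T ?s2 ?t1 //.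
  rewrite def_m s2 t1; split=> //; first by split; apply: not_lt; lra.
  by split=> // _; split; apply: not_lt; lra.
have T_ge2 : 2 <= T by rewrite ler_nat.
have /andP[E_ge E_le] := bounds T_ge2.
have T_ge4 : (4 <= t)%N -> 4 <= T by rewrite ler_nat.
have [EQ QL] : E < Q /\ Q < L.
  have [t4|t_lt4] := leqP 4 t; first by have [] := large (T_ge4 t4).
  have [t2|t3] := t_23 t_ge2 t_lt4; first by apply: lt_T2; rewrite /T t2.
  have [] // := lt_T3; by rewrite /S /T ?t3 ?t3_s2.
split.
- move: EQ QL; rewrite -!lt_val => EQ QL; split; [exact: ltW|exact: ltW| |].
    by split=> [eqEQ|m4]; [move: EQ; rewrite eqEQ ltxx | rewrite m4 in m_neq4].
  by split=> [eqQL|m4]; [move: QL; rewrite eqQL ltxx | rewrite m4 in m_neq4].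
- by split; apply: not_lt.
split=> [m3|m4|m_neq3 _]; last 1 first.
- rewrite !lt_val L_gt //; split=> //.
  have [t4|t_lt4] := leqP 4 t; first by have [] := large (T_ge4 t4).
  have s2 := s_small t_lt4 m_neq3.
  have S2 : S = 2 by rewrite /S s2.
  have [t2|t3] := t_23 t_ge2 t_lt4.
    have T2 : T = 2 by rewrite /T t2.
    by have := Q22 S2 T2; rewrite S2 T2; lra.
  have T3 : T = 3 by rewrite /T t3.
  by have [_ _] := lt_T3 S2 T3; rewrite S2 T3; lra.
- rewrite lt_val L_gt //; split=> //; apply: not_lt.
  have [s1 t2] := m3_cases m3.
  have S1 : S = 1 by rewrite /S s1.
  have T2 : T = 2 by rewrite /T t2.
  by have := Q12 S1 T2; rewrite S1 T2; lra.
by rewrite m4 in m_neq4.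
Qed.

(** * The dihedral group and its non-commuting graph *)

Local Open Scope group_scope.

(** When [b ^+ 2 = 1], the relation [b * a * b^-1 = a^-1] says the same as [a ^ b = a^-1] in
    [Grp_dihedral]; so [G] and the library's dihedral group are images of each other, hence
    isomorphic. *)
Lemma card_dihedral_presentation (m : nat) (gT : finGroupType) (G : {group gT}) :
    (1 < m)%N ->
    G \isog Grp (a : b : a ^+ m, b ^+ 2, b * a * b^-1 = a^-1) ->
  #|G| = m.*2.
Proof.
move=> m_gt1 isoG; rewrite -(card_dihedral m_gt1); apply: card_isog.
have conj_invol (hT : finGroupType) (x y : hT) : y ^+ 2 = 1 -> y * x * y^-1 = x ^ y.
  by rewrite expgS expg1 => /eqP; rewrite -eq_invg_mul conjgE => /eqP->; rewrite mulgA.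
rewrite isogEhom (Grp_dihedral m_gt1) isoG; apply/andP; split.
  have /existsP[[x y] /= /eqP[defG xm y2 xy]] := isoGrp_hom isoG.
  by apply/existsP; exists (x, y); rewrite /= !xpair_eqE defG xm y2 -conj_invol // xy !eqxx.
have /existsP[[x y] /= /eqP[defD xm y2 xy]] := isoGrp_hom (Grp_dihedral m_gt1).
by apply/existsP; exists (x, y); rewrite /= !xpair_eqE defD xm y2 conj_invol // xy !eqxx.
Qed.

(** The order of [a] divides [m], and it cannot be smaller: [G] is the product of [<[a]>] and
    [<[b]>], has [2 * m] elements, and [b] has order at most 2. *)
Lemma dihedral_rotations (m : nat) (gT : finGroupType) (G : {group gT}) :
    (1 < m)%N ->
    G \isog Grp (a : b : a ^+ m, b ^+ 2, b * a * b^-1 = a^-1) ->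
  exists a : gT, [/\ #[a] = m, <[a]> \subset G, #|G| = m.*2
    & {in <[a]> & G :\: <[a]>, forall x y, x ^ y = x^-1}].
Proof.
move=> m_gt1 isoG; have oG := card_dihedral_presentation _ _ _ m_gt1 isoG.
have /existsP[[a b] /= /eqP[defG am b2 bab]] := isoGrp_hom isoG.
have invb : b^-1 = b.
  by apply/eqP; rewrite eq_invg_mul -[b in b * b]expg1 -expgD b2.
have ab : a ^ b = a^-1 by rewrite conjgE -bab invb mulgA.
have defG' : <[a]> * <[b]> = G.
  by rewrite -norm_joinEr // norms_cycle ab groupV cycle_id.
have a_dvd : (#[a] %| m)%N by rewrite order_dvdn am.
have b_dvd : (#[b] %| 2)%N by rewrite order_dvdn b2.
have oa : #[a] = m.
  apply/eqP; rewrite eqn_leq dvdn_leq ?(ltnW m_gt1) //=.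
  rewrite -(@leq_pmul2r 2) // muln2 -oG -defG'.
  apply: (leq_trans (leq_pmulr _ (cardG_gt0 (<[a]> :&: <[b]>)))).
  by rewrite -mul_cardG -!orderE leq_mul2l dvdn_leq ?orbT.
exists a; split=> //; first by rewrite -defG' mulG_subl.
move=> x y /cycleP[i ->] /setDP[]; rewrite -defG'.
case/mulsgP=> _ _ /cycleP[j ->] /cycleP[k ->] ->.
(* An even power of [b] would put the element in [<[a]>]. *)
rewrite -(expg_mod _ b2) modn2; case: (odd k) => [_|]; last first.
  by rewrite expg0 mulg1 mem_cycle.
rewrite expg1 conjgM [_ ^ (a ^+ j)]conjgE (commuteX2 _ _ (commute_refl a)) mulKg.
by rewrite conjXg ab expVgn.
Qed.

Section Dihedral.

Variables (gT : finGroupType) (G : {group gT}) (m : nat) (a : gT).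
Hypotheses (m_ge3 : (3 <= m)%N) (oa : #[a] = m) (sRG : <[a]> \subset G)
  (oG : #|G| = m.*2).
Hypothesis invR : {in <[a]> & G :\: <[a]>, forall x y, x ^ y = x^-1}.
Local Notation R := <[a]>.

Let aR : a \in R. Proof. exact: cycle_id. Qed.

Lemma card_reflections : #|G :\: R| = m.
Proof. by rewrite cardsD (setIidPr sRG) oG -orderE oa -addnn addnK. Qed.

Lemma commute_rotation_reflection x y :
  x \in R -> y \in G :\: R -> (x * y == y * x) = (x ^+ 2 == 1).
Proof.
move=> xR yR; rewrite (conjgC x y) (invR _ _ xR yR) (can_eq (mulKg y)).
by rewrite eq_invg_mul.
Qed.

(** No reflection is central: commuting with [a] would force [a ^+ 2 = 1], against [3 <= m]. A
    rotation commutes with a reflection exactly when it is its own inverse. *)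
Lemma center_dihedral : 'Z(G) = [set z in R | z ^+ 2 == 1].
Proof.
have [b bGR] : exists b, b \in G :\: R.
  by apply/set0Pn; rewrite -card_gt0 card_reflections; apply: leq_trans m_ge3.
apply/setP=> z; rewrite [RHS]inE; apply/centerP/andP => [[zG cz]|[zR z2]].
  have [zR|zR] := boolP (z \in R).
    by split=> //; rewrite -(commute_rotation_reflection _ b) //; apply/eqP/cz; case/setDP: bGR.
  have : a * z == z * a by apply/eqP/esym/cz; apply: (subsetP sRG).
  rewrite commute_rotation_reflection // ?inE ?zR // -order_dvdn oa => /dvdn_leq.
  by move=> /(_ isT) m2; move: (leq_trans m_ge3 m2).
split=> [|y yG]; first exact: (subsetP sRG).
have [yR|yR] := boolP (y \in R).
  by have /centsP := cycle_abelian a; apply.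
by apply/eqP; rewrite commute_rotation_reflection // inE yR.
Qed.

Lemma center_sub_rotations : 'Z(G) \subset R.
Proof. by rewrite center_dihedral; apply/subsetP=> z; rewrite inE => /andP[]. Qed.

(** The center is cyclic, being a group of rotations, and the square of its generator is 1. *)
Lemma card_center_dihedral : #|'Z(G)| = 1%N \/ #|'Z(G)| = 2%N.
Proof.
have /cyclicP[z defZ] : cyclic 'Z(G) := cyclicS center_sub_rotations (cycle_cyclic a).
have := cycle_id z; rewrite -defZ {1}center_dihedral inE -order_dvdn => /andP[_ z2].
rewrite defZ -orderE.
by move: (dvdn_leq (ltn0Sn 1) z2) (order_gt0 z); case: #[z] => [|[|[|]]] //; auto.
Qed.

(** This rules out [s = 1], [t = 3], for which no estimate is made. *)
Lemma card_center_dihedral8 : m = 4%N -> #|'Z(G)| = 2%N.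
Proof.
move=> m4; have [Z1|//] := card_center_dihedral.
have : a ^+ 2 \in 'Z(G).
  by rewrite center_dihedral inE mem_cycle -expgM -order_dvdn oa m4.
by rewrite (card1_trivg Z1) inE -order_dvdn oa m4.
Qed.

Lemma lcoset_rotations x : x \in G :\: R -> x *: R = G :\: R.
Proof.
move=> /setDP[xG xR]; apply/eqP.
rewrite eqEcard card_lcoset -orderE oa card_reflections leqnn andbT.
apply/subsetP=> _ /lcosetP[r rR ->].
by rewrite inE groupMr // xR groupM // (subsetP sRG).
Qed.

(** The rotations form one part, the reflections are grouped by cosets of the
center. *)
Definition dihedral_part (x : gT) : {set gT} := if x \in R then R else x *: 'Z(G).

(** The main case is that of two reflections [x] and [y = x * r]: they commute iff [r] commutes with
    [x], that is, iff the rotation [r] is central. A coset [x *: 'Z(G)] of a reflection is never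
    [R], since it contains [x]. *)
Lemma dihedral_partE : {in G :\: 'Z(G) &, forall x y,
  (x * y != y * x) = (dihedral_part x != dihedral_part y)}.
Proof.
move=> x y /setDP[xG xZ] /setDP[yG yZ]; congr (~~ _); rewrite /dihedral_part.
have notZ z : z \in R -> z \notin 'Z(G) -> z ^+ 2 == 1 = false.
  by move=> zR; rewrite center_dihedral inE zR => /negbTE.
have lcosetR z : z \notin R -> (z *: 'Z(G) == R) = false.
  by move=> zR; apply: contraNF zR => /eqP <-; rewrite lcoset_refl.
case: (boolP (x \in R)) => xR; case: (boolP (y \in R)) => yR.
- by rewrite eqxx; apply/eqP; have /centsP := cycle_abelian a; apply.
- by rewrite commute_rotation_reflection ?inE ?yR // notZ // eq_sym lcosetR.
- by rewrite eq_sym commute_rotation_reflection ?inE ?xR // notZ // lcosetR.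
have xGR : x \in G :\: R by rewrite inE xR.
have : y \in x *: R by rewrite lcoset_rotations // inE yR.
case/lcosetP=> r rR defy.
have -> : (x * y == y * x) = (r * x == x * r).
  by rewrite defy -mulgA (inj_eq (mulgI x)) eq_sym.
rewrite commute_rotation_reflection // defy.
transitivity (r \in 'Z(G)); first by rewrite center_dihedral inE rR.
by rewrite eq_sym (sameP eqP lcoset_eqP) mem_lcoset mulKg.
Qed.


Lemma card_noncentral (P : pred gT) :
  #|[pred x : noncentral G | P (val x)]| = #|[set x in G :\: 'Z(G) | P x]|.
Proof.
rewrite -(card_image val_inj); apply: eq_card => x; rewrite [RHS]inE.
apply/imageP/andP => [[y Py ->]|[xGZ Px]]; first by split=> //; exact: (valP y).
by exists (Sub x xGZ) => //; rewrite inE SubK.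
Qed.

Lemma multipartite_noncommuting k : m = (#|'Z(G)| * k.+1)%N ->
  multipartite (noncommuting_graph G) (#|'Z(G)| * k) k.+1 #|'Z(G)|.
Proof.
move=> def_m; have sZR := center_sub_rotations; have sZG := center_sub G.
exists {set gT}, (fun x => dihedral_part (val x)), R; split.
- by move=> x y; rewrite -dihedral_partE; [|exact: (valP x)|exact: (valP y)].
- rewrite /part_size (card_noncentral (fun x => dihedral_part x == R)).
  have -> : [set x in G :\: 'Z(G) | dihedral_part x == R] = R :\: 'Z(G).
    apply/setP=> x; rewrite !inE /dihedral_part.
    case: (boolP (x \in R)) => xR; first by rewrite eqxx (subsetP sRG) // !andbT.
    rewrite andbF; apply: contraNF xR => /andP[_ /eqP<-].
    exact: lcoset_refl.
  by rewrite cardsD (setIidPr sZR) -orderE oa def_m mulnS addKn.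
- move=> A A_neqR; rewrite /part_size (card_noncentral (fun x => dihedral_part x == A)).
  set B := [set x in _ | _]; have [->|[x]] := set_0Vmem B; first by left; rewrite cards0.
  rewrite inE => /andP[/setDP[xG xZ] /eqP part_x]; right.
  have xR : x \notin R by apply: contraNN A_neqR => xR; rewrite -part_x /dihedral_part xR.
  have defA : A = x *: 'Z(G) by rewrite -part_x /dihedral_part (negbTE xR).
  rewrite -(card_lcoset 'Z(G) x); apply: eq_card => y; rewrite inE.
  apply/andP/idP => [[_ /eqP]|yxZ].
    rewrite /dihedral_part; case: ifP => _ defA'; first by rewrite defA' eqxx in A_neqR.
    by rewrite -defA -defA' lcoset_refl.
  have yR : y \notin R.
    have /lcosetP[z zZ ->] := yxZ.
    by rewrite groupMr // (subsetP sZR).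
  split.
    rewrite inE (contra (subsetP sZR y)) //=.
    by have /lcosetP[z zZ ->] := yxZ; rewrite groupM // (subsetP sZG).
  by rewrite /dihedral_part (negbTE yR) defA; apply/eqP/lcoset_eqP.
(* The reflection parts are not counted one by one; [2 * m - #|'Z(G)|] is the required total. *)
transitivity #|G :\: 'Z(G)|; first by rewrite card_sig; apply: eq_card.
rewrite cardsD (setIidPr sZG) oG def_m.
move: #|_| => s; lia.
Qed.

End Dihedral.

(** Here [s] is the order of the center, which divides the number [m] of rotations, and [t + 1] is
    the quotient. *)
Lemma noncommuting_dihedral (m : nat) (gT : finGroupType) (G : {group gT}) :
    (3 <= m)%N ->
    G \isog Grp (a : b : a ^+ m, b ^+ 2, b * a * b^-1 = a^-1) ->
  exists s t : nat, [/\ multipartite (noncommuting_graph G) (s * t) t.+1 s,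
    m = (s * t.+1)%N & [\/ s = 1%N /\ t = 2%N, s = 2%N /\ (1 <= t <= 3)%N
                        | (s = 1%N \/ s = 2%N) /\ (4 <= t)%N]].
Proof.
move=> m_ge3 isoG.
have [a [oa sRG oG invR]] := dihedral_rotations _ _ _ (ltnW m_ge3) isoG.
have := cardSg (center_sub_rotations _ _ _ _ m_ge3 oa sRG oG invR).
rewrite -orderE oa => /dvdnP[[|t]]; first by move=> m0; rewrite m0 in m_ge3.
rewrite mulnC => def_m; exists #|'Z(G)|, t; split=> //.
  exact: (multipartite_noncommuting _ _ _ _ m_ge3 oa sRG oG invR).
have Z12 := card_center_dihedral _ _ _ _ m_ge3 oa sRG oG invR.
have Z8 := card_center_dihedral8 _ _ _ _ m_ge3 oa sRG oG invR.
(* [3 <= m] excludes [m = 1] and [m = 2], and [Z8] excludes [s = 1] with [m = 4]. *)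
move: def_m Z12 Z8; move: #|_| => s def_m [] s_eq Z8; rewrite s_eq in def_m Z8 *.
  have [t4|t_lt4] := leqP 4 t; first by constructor 3; split; [left|].
  by constructor 1; split=> //; lia.
have [t4|t_lt4] := leqP 4 t; first by constructor 3; split; [right|].
by constructor 2; split=> //; lia.
Qed.

Local Close Scope group_scope.

Theorem theorem2p4 (m : nat) (m_ge3 : (3 <= m)%N)
    (gT : finGroupType) (G : {group gT})
    (G_dihedral :
      (G \isog Grp (a : b : a ^+ m, b ^+ 2, b * a * b^-1 = a^-1))%g) :
  let Gamma := noncommuting_graph G in
  [/\ [/\ energy Gamma <= Q_energy Gamma,
          Q_energy Gamma <= L_energy Gamma,
          energy Gamma = Q_energy Gamma <-> m = 4%N
        & Q_energy Gamma = L_energy Gamma <-> m = 4%N],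
      ~ hypoenergetic Gamma /\ ~ hyperenergetic Gamma
    & [/\ m = 3%N -> L_hyperenergetic Gamma /\ ~ Q_hyperenergetic Gamma,
          m = 4%N -> ~ L_hyperenergetic Gamma /\ ~ Q_hyperenergetic Gamma
        & m <> 3%N -> m <> 4%N ->
          Q_hyperenergetic Gamma /\ L_hyperenergetic Gamma]].
Proof.
have [s [t [Gamma_multi def_m cases]]] := noncommuting_dihedral m gT G m_ge3 G_dihedral.
exact: energy_comparison Gamma_multi def_m cases.
Qed.
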